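(* For each integer $n\ge 1$ let $$\mathcal{T}(n)=\{\,f\in\mathbb{F}_q[t] \text{ monic}:\ \deg f=n,\ S(f)\neq t^{\deg \mathcal{P}(f)}\,\}.$$ Then $$|\mathcal{T}(n)|<\begin{cases}2^{n+2}\exp(-\sqrt{n}/3), & \text{if } q=2 \text{ and } n\ge 3249,\\ 4q^n\exp(-\sqrt{n}/2), & \text{if } q\ge 3 \text{ and } n\ge \max\{13000,\log q\}.\end{cases}$$
   Context: Let $\mathbb{F}_q$ be a finite field with $q$ elements ($q$ a prime power). Fix an enumeration $\mathbb{F}_q=\{a_0,a_1,\dots,a_{q-1}\}$ with $a_0=0$, $a_1=1$. Every nonzero $f\in\mathbb{F}_q[t]$ of degree $m$ is uniquely written $f=a_{i_0}+a_{i_1}t+\dots+a_{i_m}t^m$ with $0\le i_j\le q-1$, $a_{i_m}\neq 0$. Put $\delta(f)=i_0+i_1q+\dots+i_mq^m$ and $\delta(0)=0$; $\delta$ is a bijection from $\mathbb{F}_q[t]$ to the non-negative integers. Order $\mathbb{F}_q[t]$ by: $f>g$ iff $\delta(f)>\delta(g)$. For nonzero $f$, the factorial is $f!=\prod_{g<f}(f-g)$ (product over all $g\in\mathbb{F}_q[t]$ with $g<f$), and $0!=1$. For nonzero $f$, $S(f)$ is the smallest $g\in\mathbb{F}_q[t]$ (in this order) such that $f\mid g!$; $S(0)=0$. For a non-constant $f$, $\mathcal{P}(f)$ denotes the maximal (in this order) monic irreducible factor of $f$. Here $\log$ is the natural logarithm. *)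

(* Defs.v *)
From HB Require Import structures.
From mathcomp Require Import all_boot all_order all_algebra.
From mathcomp Require Import all_classical all_reals all_analysis.

Set Implicit Arguments.
Unset Strict Implicit.
Unset Printing Implicit Defensive.

Import Order.TTheory GRing.Theory Num.Theory.
Local Open Scope ring_scope.

(* Throughout, [a] lists the elements a_0, ..., a_(q-1) of F, so that the
   index i with a_i = x is [index x a]. *)

Definition delta (F : finFieldType) (a : #|F|.-tuple F) (f : {poly F}) : nat :=
  (\sum_(i < size f) index (f`_i)%R a * #|F| ^ i)%N.

(* Any g with delta g < delta f satisfies size g <= size f (see [delta_size]),
   so the product ranges over all the predecessors of f; it is empty if f = 0. *)
Definition pfact (F : finFieldType) (a : #|F|.-tuple F) (f : {poly F}) :
    {poly F} :=
  \prod_(g : {poly_(size f) F} | (delta a g < delta a f)%N) (f - val g).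

Definition is_smallest (F : finFieldType) (a : #|F|.-tuple F)
    (D : set {poly F}) (g : {poly F}) : Prop :=
  D g /\ forall h, D h -> (delta a g <= delta a h)%N.

Definition is_largest (F : finFieldType) (a : #|F|.-tuple F)
    (D : set {poly F}) (g : {poly F}) : Prop :=
  D g /\ forall h, D h -> (delta a h <= delta a g)%N.

Definition smarandache (F : finFieldType) (a : #|F|.-tuple F) (f : {poly F}) :
    {poly F} :=
  if f == 0 then 0 else xget 0 (is_smallest a (fun g => f %| pfact a g)).

Definition max_prime (F : finFieldType) (a : #|F|.-tuple F) (f : {poly F}) :
    {poly F} :=
  xget 0 (is_largest a
    (fun p => [/\ p \is monic, irreducible_poly p & p %| f])).

Definition Tset (F : finFieldType) (a : #|F|.-tuple F) (n : nat) :
    {set {poly_n.+1 F}} :=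
  [set f : {poly_n.+1 F} | [&& val f \is monic, size (val f) == n.+1 &
     smarandache a (val f) != 'X^((size (max_prime a (val f))).-1)]].

(* The facts below show that [delta] is injective, that [pfact] is the product
   over all predecessors, and that the two [xget] never return their default
   value on the relevant arguments. *)

Lemma mem_enumeration (F : finFieldType) (a : #|F|.-tuple F) (x : F) :
  uniq a -> x \in (a : seq F).
Proof.
move=> ua; have /subset_cardP E : #|(a : seq F)| = #|F|.
  by rewrite (card_uniqP ua) size_tuple.
by have /E-> : (a : seq F) \subset F by exact/fintype.subsetP.
Qed.

Lemma sum_digits_lt (q n : nat) (c : nat -> nat) :
  (forall i, c i < q)%N -> (\sum_(i < n) c i * q ^ i < q ^ n)%N.
Proof.
move=> cq; elim: n => [|n IH]; first by rewrite big_ord0.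
rewrite big_ord_recr /= expnS.
apply: (@leq_trans (q ^ n + c n * q ^ n)%N); first by rewrite ltn_add2r.
by rewrite -mulSn leq_mul2r cq orbT.
Qed.

Lemma sum_digits_inj (q n : nat) (c d : nat -> nat) :
  (forall i, c i < q)%N -> (forall i, d i < q)%N ->
  (\sum_(i < n) c i * q ^ i = \sum_(i < n) d i * q ^ i)%N ->
  forall i, (i < n)%N -> c i = d i.
Proof.
move=> cq dq; have q0 : (0 < q)%N by exact: leq_ltn_trans (cq 0%N).
elim: n => [//|n IH]; rewrite !big_ord_recr /= => E.
have lc := sum_digits_lt n cq; have ld := sum_digits_lt n dq.
have := congr1 (divn^~ (q ^ n)%N) E; have := congr1 (modn^~ (q ^ n)%N) E.
rewrite /= !(addnC (\sum_(_ < _) _)%N) !modnMDl !modn_small // => /IH{}IH.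
rewrite !divnMDl ?expn_gt0 ?q0 // !divn_small // !addn0 => En i.
by rewrite ltnS leq_eqVlt => /predU1P[->|/IH].
Qed.

Lemma index_enum_lt (F : finFieldType) (a : #|F|.-tuple F) (x : F) :
  uniq a -> (index x a < #|F|)%N.
Proof.
move=> ua; rewrite -[X in (_ < X)%N](size_tuple a) index_mem.
exact: mem_enumeration.
Qed.

Lemma index_enum0 (F : finFieldType) (a : #|F|.-tuple F) :
  uniq a -> a`_0 = 0 -> index 0 a = 0%N.
Proof.
by move=> ua a0; rewrite -[X in index X]a0 index_uniq // size_tuple (cardD1 0).
Qed.

Lemma index_enum1 (F : finFieldType) (a : #|F|.-tuple F) :
  uniq a -> a`_1 = 1 -> index 1 a = 1%N.
Proof.
move=> ua a1; rewrite -[X in index X]a1 index_uniq // size_tuple.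
by rewrite card_finNzRing_gt1.
Qed.

Lemma deltaE (F : finFieldType) (a : #|F|.-tuple F) (f : {poly F}) (n : nat) :
  uniq a -> a`_0 = 0 -> (size f <= n)%N ->
  delta a f = (\sum_(i < n) index (f`_i)%R a * #|F| ^ i)%N.
Proof.
move=> ua a0 /subnKC <-; rewrite big_split_ord /= [X in (_ + X)%N]big1 ?addn0 //.
by move=> i _; rewrite nth_default ?leq_addr // index_enum0.
Qed.

Lemma delta_inj (F : finFieldType) (a : #|F|.-tuple F) :
  uniq a -> a`_0 = 0 -> injective (delta a).
Proof.
move=> ua a0 f g; set n := maxn (size f) (size g).
rewrite (@deltaE _ a f n) ?leq_maxl // (@deltaE _ a g n) ?leq_maxr // => E.
apply/polyP=> i; case: (ltnP i n) => [lin|].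
  apply: (index_inj 0 (mem_enumeration _ ua) (mem_enumeration _ ua)).
  exact: (@sum_digits_inj #|F| n (fun i => index (f`_i)%R a)
    (fun i => index (g`_i)%R a) (fun=> index_enum_lt _ ua)
    (fun=> index_enum_lt _ ua) E i lin).
by rewrite geq_max => /andP[? ?]; rewrite !nth_default.
Qed.

Lemma delta_ub (F : finFieldType) (a : #|F|.-tuple F) (f : {poly F}) :
  uniq a -> (delta a f < #|F| ^ size f)%N.
Proof.
by move=> ua; apply: (sum_digits_lt _ (c := fun i => index (f`_i)%R a)) => i;
   exact: index_enum_lt.
Qed.

Lemma delta_lb (F : finFieldType) (a : #|F|.-tuple F) (f : {poly F}) :
  uniq a -> a`_0 = 0 -> f != 0 -> (#|F| ^ (size f).-1 <= delta a f)%N.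
Proof.
move=> ua a0 f0; rewrite /delta; have := f0; rewrite -size_poly_gt0.
case E: (size f) => [//|n] _ /=; rewrite big_ord_recr /=.
apply: leq_trans (leq_addl _ _); apply: leq_pmull; rewrite lt0n.
apply: contra f0 => /eqP; rewrite -(index_enum0 ua a0).
move=> /(index_inj 0 (mem_enumeration _ ua) (mem_enumeration _ ua)) fn0.
by rewrite -lead_coef_eq0 lead_coefE E /= fn0.
Qed.

Lemma delta_size (F : finFieldType) (a : #|F|.-tuple F) (f g : {poly F}) :
  uniq a -> a`_0 = 0 -> (delta a g < delta a f)%N -> (size g <= size f)%N.
Proof.
move=> ua a0 lt_gf; have [->|g0] := eqVneq g 0; first by rewrite size_poly0.
have := leq_ltn_trans (delta_lb ua a0 g0) (ltn_trans lt_gf (delta_ub f ua)).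
rewrite ltn_exp2l ?card_finNzRing_gt1 //; move: g0; rewrite -size_poly_gt0.
by case: (size g).
Qed.

Lemma deltaXn (F : finFieldType) (a : #|F|.-tuple F) (m : nat) :
  uniq a -> a`_0 = 0 -> a`_1 = 1 -> delta a 'X^m = (#|F| ^ m)%N.
Proof.
move=> ua a0 a1; rewrite /delta size_polyXn big_ord_recr /= coefXn eqxx.
rewrite index_enum1 // mul1n big1 ?add0n // => i _.
by rewrite coefXn ltn_eqF ?ltn_ord // index_enum0.
Qed.

Lemma dvd_pfact (F : finFieldType) (a : #|F|.-tuple F) (f g : {poly F}) :
  uniq a -> a`_0 = 0 -> (delta a g < delta a f)%N -> f - g %| pfact a f.
Proof.
move=> ua a0 lt_gf; have sg := delta_size ua a0 lt_gf.
by rewrite /pfact (bigD1 (NPoly sg)) //= dvdp_mulIl.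
Qed.

Lemma smarandacheP (F : finFieldType) (a : #|F|.-tuple F) (f : {poly F}) :
  uniq a -> a`_0 = 0 -> a`_1 = 1 -> f != 0 ->
  is_smallest a (fun g => f %| pfact a g) (smarandache a f).
Proof.
move=> ua a0 a1 f0; rewrite /smarandache (negPf f0); apply: xgetPex.
set m := (size f).-1; pose h := (lead_coef f)^-1 *: f.
have hm : h \is monic by rewrite monicE lead_coefZ mulVf // lead_coef_eq0.
have sh : size h = m.+1.
  by rewrite size_scale ?invr_eq0 ?lead_coef_eq0 // prednK // size_poly_gt0.
have fX : f %| pfact a 'X^m.
  rewrite -(@dvdpZl _ (lead_coef f)^-1) ?invr_eq0 ?lead_coef_eq0 // -/h.
  rewrite -[h](subKr 'X^m); apply: dvd_pfact => //; rewrite deltaXn //.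
  apply: leq_trans (delta_ub _ ua) _; rewrite leq_exp2l ?card_finNzRing_gt1 //.
  apply/leq_sizeP => j lemj; rewrite coefB coefXn.
  move: lemj; rewrite leq_eqVlt => /predU1P[<-|ltmj].
    by rewrite eqxx -(monicP hm) lead_coefE sh subrr.
  by rewrite gtn_eqF // nth_default ?sh // subr0.
have exg : exists n, `[< exists2 g, f %| pfact a g & delta a g = n >].
  by exists (delta a 'X^m); apply/asboolP; exists 'X^m.
case: (ex_minnP exg) => _ /asboolP[g fg <-] gmin; exists g; split=> // k fk.
by apply: gmin; apply/asboolP; exists k.
Qed.

Lemma max_primeP (F : finFieldType) (a : #|F|.-tuple F) (f : {poly F}) :
  uniq a -> (1 < size f)%N ->
  is_largest a (fun p => [/\ p \is monic, irreducible_poly p & p %| f])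
    (max_prime a f).
Proof.
move=> ua sf; apply: xgetPex.
have f0 : f != 0 by rewrite -size_poly_gt0 ltnW.
pose D := fun p : {poly F} => [/\ p \is monic, irreducible_poly p & p %| f].
have exs : exists n, `[< exists2 p, p %| f & (1 < size p)%N /\ size p = n >].
  by exists (size f); apply/asboolP; exists f.
have [p Dp] : exists p, D p.
  case: (ex_minnP exs) => _ /asboolP[p pf [sp <-]] pmin.
  have p0 : p != 0 by rewrite -size_poly_gt0 ltnW.
  have u : (lead_coef p)^-1 != 0 by rewrite invr_eq0 lead_coef_eq0.
  exists ((lead_coef p)^-1 *: p); split.
  - by rewrite monicE lead_coefZ mulVf // lead_coef_eq0.
  - split; first by rewrite size_scale.
    move=> r sr; rewrite dvdpZr // => rp.
    apply: (@eqp_trans _ p); last by rewrite eqp_sym eqp_scale.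
    rewrite -dvdp_size_eqp // eqn_leq dvdp_leq //=; apply: pmin.
    apply/asboolP; exists r; first exact: dvdp_trans pf.
    split=> //; rewrite ltn_neqAle eq_sym sr size_poly_gt0.
    by apply: contraTneq rp => ->; rewrite dvd0p.
  - by rewrite dvdpZl.
have exD : exists n, `[< exists2 p, D p & delta a p = n >].
  by exists (delta a p); apply/asboolP; exists p.
have ubD n : `[< exists2 p, D p & delta a p = n >] -> (n <= #|F| ^ size f)%N.
  move=> /asboolP[r [_ _ rf] <-]; apply: leq_trans (ltnW (delta_ub r ua)) _.
  by rewrite leq_exp2l ?card_finNzRing_gt1 // dvdp_leq.
case: (ex_maxnP exD ubD) => _ /asboolP[r Dr <-] rmax; exists r; split=> // k Dk.
by apply: rmax; apply/asboolP; exists k.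
Qed.

(* Main.v *)
Require Import Defs.
From HB Require Import structures.
From mathcomp Require Import all_boot all_order all_algebra.
From mathcomp Require Import all_classical all_reals all_analysis.
From mathcomp Require Import ring lra zify.

Set Implicit Arguments.
Unset Strict Implicit.
Unset Printing Implicit Defensive.

Import Order.TTheory GRing.Theory Num.Theory.
Local Open Scope ring_scope.

(* Writing d for the degree of the largest prime factor P of f, P divides no
   g! with deg g < d, while (t^d)! is the product of all monic polynomials of
   degree d; hence S(f) = t^d as soon as f divides (t^d)!. For an irreducible p
   of degree k <= d the power p^(q^(d-k)) divides (t^d)!, so every f in T(n) is
   divisible by some p^(1 + q^(d-k)).

   Let D be least with q^D >= exp(sigma), where sigma is sqrt n / 3 or
   sqrt n / 2. The f with d >= D number at most the sum over d >= D and k <= d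
   of q^(n - k q^(d-k)), which is O(q^(n-D)). The f with d < D are smooth;
   Rankin's trick with the parameter x = 1 / (q (1 - 3 / sqrt n)), using only
   the trivial bound q^k on the number of primes of degree k, shows that there
   are at most q^n exp(-sigma) of them. *)

(** * The factorial of a power of t *)

Lemma exists_irreducible_dvdp (F : finFieldType) (f : {poly F}) :
  (1 < size f)%N ->
  exists p, [/\ p \is monic, irreducible_poly p & p %| f].
Proof.
have ua : uniq (enum_tuple F) by rewrite enum_uniq.
move=> sf; have [? _] := max_primeP ua sf.
by exists (max_prime (enum_tuple F) f).
Qed.

Lemma irreducible_dvdp_prod (F : fieldType) (I : Type) (r : seq I)
    (P : pred I) (h : I -> {poly F}) (p : {poly F}) :
  irreducible_poly p -> p %| \prod_(i <- r | P i) h i ->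
  exists2 i, P i & p %| h i.
Proof.
move=> ip; elim: r => [|i r IH].
  by rewrite big_nil dvdp1; case: ip => + _ /eqP sp; rewrite sp.
rewrite big_cons; case: ifP => // Pi.
have [pi _|npi] := boolP (p %| h i); first by exists i.
by rewrite Gauss_dvdpr ?irreducible_poly_coprime.
Qed.

Lemma expp_dvdp_prod (F : fieldType) (I : Type) (r : seq I) (P Q : pred I)
    (h : I -> {poly F}) (p : {poly F}) :
  (forall i, Q i -> p %| h i) ->
  p ^+ count (predI P Q) r %| \prod_(i <- r | P i) h i.
Proof.
move=> Qp; elim: r => [|i r IH]; first by rewrite big_nil dvd1p.
rewrite big_cons /=; case: (P i) => //=.
case Qi: (Q i); first by rewrite exprS dvdp_mul // Qp.
by rewrite dvdp_mull.
Qed.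

Lemma monic_size_subXn (F : fieldType) (f : {poly F}) (n : nat) :
  f \is monic -> size f = n.+1 -> (size (f - 'X^n)%R <= n)%N.
Proof.
move=> fm sf; apply/leq_sizeP => j; rewrite coefB coefXn leq_eqVlt.
case/predU1P => [<-|lt].
  by rewrite eqxx -(monicP fm) lead_coefE sf subrr.
by rewrite gtn_eqF // nth_default ?sf // subr0.
Qed.

Lemma size_XnDnpoly (F : fieldType) (n : nat) (g : {poly_n F}) :
  size ('X^n + val g) = n.+1.
Proof. by rewrite size_polyDl ?size_polyXn // ltnS size_npoly. Qed.

Lemma monic_XnDnpoly (F : fieldType) (n : nat) (g : {poly_n F}) :
  'X^n + val g \is monic.
Proof.
rewrite monicE lead_coefDl ?lead_coefXn //.
by rewrite size_polyXn ltnS size_npoly.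
Qed.

Lemma monic_XnDnpolyP (F : fieldType) (f : {poly F}) (n : nat) :
  f \is monic -> size f = n.+1 -> exists g : {poly_n F}, f = 'X^n + val g.
Proof.
move=> fm sf; exists (NPoly (monic_size_subXn fm sf)).
by rewrite /= addrC subrK.
Qed.

(** Stands in for unique factorization: the full power [p ^+ e] of one irreducible factor is split
    off, the cofactor [h] is coprime to it, and induction on a size bound handles [h]. *)
Lemma dvdp_from_prime_powers (F : finFieldType) (f g : {poly F}) :
  f != 0 ->
  (forall p e, p \is monic -> irreducible_poly p -> p ^+ e %| f ->
     p ^+ e %| g) -> f %| g.
Proof.
move: {2}(size f) (leqnn (size f)) => N.
elim: N f => [|N IH] f; first by rewrite leqn0 size_poly_eq0 => /eqP -> /eqP.
move=> sf f0 H; have [sf1|sf1] := leqP (size f) 1.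
  have : f %= 1 by rewrite -size_poly_eq1 eqn_leq sf1 size_poly_gt0.
  by move=> /eqp_dvdl ->; rewrite dvd1p.
have [p [pm ip pf]] := exists_irreducible_dvdp sf1.
have sp : (1 < size p)%N by case: ip.
have p0 : p != 0 by rewrite -size_poly_gt0 ltnW.
have exe : exists e, p ^+ e %| f by exists 0%N; rewrite expr0 dvd1p.
(* Exponents of powers of [p] dividing [f] are bounded by the size of [f], so a largest one
   exists. *)
have see e : (e < size (p ^+ e))%N.
  have := size_exp p e; have : (0 < size (p ^+ e))%N.
    by rewrite size_poly_gt0 monic_neq0 // monic_exp.
  have : (e <= (size p).-1 * e)%N by rewrite leq_pmull // -subn1 subn_gt0.
  by move=> + + E; rewrite -E; lia.
have ube e : p ^+ e %| f -> (e <= size f)%N.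
  by move=> /(dvdp_leq f0); apply: leq_trans; apply: ltnW.
case: (ex_maxnP exe ube) => e pef emax.
have e0 : (0 < e)%N by apply: emax; rewrite expr1.
have Ef : f = (f %/ p ^+ e) * p ^+ e by rewrite divpK.
set h := f %/ _ in Ef; clearbody h.
have h0 : h != 0 by apply: contra_neq f0 => h0; rewrite Ef h0 mul0r.
have hf : h %| f by rewrite Ef dvdp_mulr.
have nph : ~~ (p %| h).
  apply/negP => ph; have: (e.+1 <= e)%N; last by rewrite ltnn.
  by apply: emax; rewrite Ef exprS dvdp_mul.
rewrite Ef mulrC Gauss_dvdp; last first.
  by rewrite coprimep_pexpl // irreducible_poly_coprime.
rewrite H //=; apply: IH => //.
  move: sf; rewrite Ef size_Mmonic ?monic_exp //.
  have := leq_ltn_trans e0 (see e).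
  case: (size (p ^+ e)) => [|[|k]] // _; rewrite !addnS /= ltnS.
  by apply: leq_trans; exact: leq_addr.
by move=> r k rm ir rh; apply: H => //; exact: dvdp_trans hf.
Qed.

(** * When S(f) is a power of t *)

Section Smarandache.
Variables (F : finFieldType) (a : #|F|.-tuple F).
Hypotheses (ua : uniq a) (a0 : a`_0 = 0) (a1 : a`_1 = 1).

(* The monic multiples of p of degree d account for q ^ (d - deg p) factors. *)
Lemma expp_dvdp_pfactXn (p : {poly F}) (k d : nat) :
  p \is monic -> size p = k.+1 -> (k <= d)%N ->
  p ^+ (#|F| ^ (d - k)) %| pfact a 'X^d.
Proof.
move=> pm sp kd; rewrite /pfact.
set n := size _; pose P := [pred g : {poly_n F} | (delta a g < delta a 'X^d)%N].
pose Q := [pred g : {poly_n F} | p %| 'X^d - val g].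
have : p ^+ count (predI P Q) (index_enum {poly_n F}) %|
    \prod_(g : {poly_n F} | P g) ('X^d - val g) by exact: expp_dvdp_prod.
apply: dvdp_trans.
apply: dvdp_exp2l; rewrite -card_npoly.
have En : n = d.+1 by rewrite /n size_polyXn.
have szp (u : {poly_(d - k) F}) : size (p * ('X^(d - k) + val u)) = d.+1.
  by rewrite size_monicM ?monic_neq0 ?monic_XnDnpoly // size_XnDnpoly sp; lia.
have mp (u : {poly_(d - k) F}) : p * ('X^(d - k) + val u) \is monic.
  by rewrite monicMl // monic_XnDnpoly.
have szg (u : {poly_(d - k) F}) :
    (size ('X^d - p * ('X^(d - k) + val u))%R <= d)%N.
  by rewrite -opprB size_polyN monic_size_subXn.
have szn (u : {poly_(d - k) F}) :
    (size ('X^d - p * ('X^(d - k) + val u))%R <= n)%N.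
  by rewrite En ltnW // ltnS.
(* The factor of the product at [phi u] is ['X^d - phi u], which is exactly the chosen monic
   multiple of [p]; [phi u] has degree below d, so it precedes ['X^d]. *)
pose phi u := NPoly (szn u).
have phi_inj : injective phi.
  move=> u v /(congr1 val) /= /addrI /oppr_inj /(mulfI (monic_neq0 pm)) /addrI.
  exact: val_inj.
have -> : count (predI P Q) (index_enum {poly_n F}) = #|predI P Q|.
  by rewrite -sum1_count -sum1_card; apply: eq_bigl.
rewrite -(card_codom phi_inj); apply: subset_leq_card.
apply/fintype.subsetP => g /codomP[u ->]; rewrite !inE /=.
rewrite subKr dvdp_mulr // andbT deltaXn //.
apply: leq_trans (delta_ub _ ua) _.
by rewrite leq_exp2l ?card_finNzRing_gt1 // szg.
Qed.

(** [p] divides a nonzero factor [g - h] with [h] preceding [g]. Applied to P and S(f), this yields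
    deg S(f) >= deg P. *)
Lemma size_le_irreducible_dvdp_pfact (p g : {poly F}) :
  irreducible_poly p -> p %| pfact a g -> (size p <= size g)%N.
Proof.
move=> ip /(irreducible_dvdp_prod ip)[h lt ph].
apply: leq_trans (dvdp_leq _ ph) _.
  by rewrite subr_eq0; apply: contraTneq lt => <-; rewrite ltnn.
rewrite (leq_trans (size_polyD _ _)) // size_polyN geq_max leqnn.
exact: size_npoly.
Qed.

(** With d = deg P, minimality gives S(f) <= t^d. Conversely P divides S(f)!, so deg S(f) >= d, and
    t^d is the first polynomial of degree d. *)
Lemma smarandache_eqXn (f : {poly F}) :
  (1 < size f)%N -> f %| pfact a 'X^((size (max_prime a f)).-1) ->
  smarandache a f = 'X^((size (max_prime a f)).-1).
Proof.
move=> sf; set p := max_prime a f; have [[pm ip pf] _] := max_primeP ua sf.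
have f0 : f != 0 by rewrite -size_poly_gt0 ltnW.
have [fS Smin] := smarandacheP ua a0 a1 f0.
move=> fX; apply: (delta_inj ua a0); apply/eqP; rewrite eqn_leq Smin //=.
have sp := size_le_irreducible_dvdp_pfact ip (dvdp_trans pf fS).
have p0 : (0 < size p)%N by rewrite size_poly_gt0 monic_neq0.
have S0 : smarandache a f != 0 by rewrite -size_poly_gt0 (leq_trans p0).
rewrite deltaXn // (leq_trans _ (delta_lb ua a0 S0)) //.
by rewrite leq_exp2l ?card_finNzRing_gt1 // -!subn1 leq_sub2r.
Qed.

(** By contraposition: otherwise each prime power p^e dividing f, with deg p = k and deg P = d, has
    e <= q^(d-k), hence divides (t^d)!. *)
Lemma smarandache_neqXn (f : {poly F}) :
  (1 < size f)%N ->
  smarandache a f != 'X^((size (max_prime a f)).-1) ->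
  exists p, [/\ p \is monic, irreducible_poly p,
    (size p <= size (max_prime a f))%N &
    p ^+ (#|F| ^ (size (max_prime a f) - size p)).+1 %| f].
Proof.
move=> sf; apply: contraNP => H; apply/eqP; apply: smarandache_eqXn => //.
have [[pm ip pf] pmax] := max_primeP ua sf.
have f0 : f != 0 by rewrite -size_poly_gt0 ltnW.
apply: dvdp_from_prime_powers => // p e {}pm {}ip pef.
case: e pef => [|e] pef; first by rewrite expr0 dvd1p.
have {}pf : p %| f by apply: dvdp_trans pef; rewrite exprS dvdp_mulr.
have sp : (1 < size p)%N by case: ip.
set P := max_prime a f in H pmax *.
have sP : (size p <= size P)%N.
  have p0 : p != 0 by rewrite monic_neq0.
  have := pmax _ (And3 pm ip pf); rewrite leq_eqVlt => /predU1P[|].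
    by move/(delta_inj ua a0) ->.
  exact: delta_size.
have leP : ((size p).-1 <= (size P).-1)%N by rewrite -!subn1 leq_sub2r.
apply: dvdp_trans (expp_dvdp_pfactXn pm (esym (prednK (ltnW sp))) leP).
apply: dvdp_exp2l; rewrite leqNgt; apply/negP => lt; apply: H.
exists p; split => //; apply: dvdp_trans pef; apply: dvdp_exp2l.
rewrite -[X in (X - _)%N](prednK (leq_trans (ltnW sp) sP)).
by rewrite -[X in (_ - X)%N](prednK (ltnW sp)).
Qed.

End Smarandache.

(** * Counting *)

(* Rankin's bound, without generating functions: a smooth f either avoids the
   first prime p of the list, or f / p is smooth of smaller degree; the right
   hand side satisfies the corresponding recursion. *)
Lemma smooth_rankin_bound (R : realFieldType) (F : finFieldType) (x : R)
    (L : seq {poly F}) (n : nat) :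
  0 < x -> x < 1 -> (forall p, p \in L -> p \is monic /\ (1 < size p)%N) ->
  exists2 s : seq {poly F},
    (size s)%:R * x ^+ n <= \prod_(p <- L) (1 - x ^+ (size p).-1)^-1 &
    forall f, f \is monic -> size f = n.+1 ->
      (forall p, p \is monic -> irreducible_poly p -> p %| f -> p \in L) ->
      f \in s.
Proof.
move=> x0 x1; elim: L n => [|p L IH] n HL.
  rewrite big_nil; case: n => [|n].
    exists [:: 1]; first by rewrite expr0 mulr1.
    move=> f fm /eqP sf _.
    by rewrite inE -eqp_monic ?monic1 // -size_poly_eq1 sf.
  exists [::]; first by rewrite mul0r.
  move=> f fm sf H; have sf1 : (1 < size f)%N by rewrite sf.
  by have [p [pm ip pf]] := exists_irreducible_dvdp sf1; have := H _ pm ip pf.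
have [pm sp] : p \is monic /\ (1 < size p)%N by apply: HL; rewrite mem_head.
have {}HL q : q \in L -> q \is monic /\ (1 < size q)%N.
  by move=> qL; apply: HL; rewrite inE qL orbT.
rewrite big_cons; set A := \prod_(_ <- _) _ in IH *.
have A0 : 0 <= A.
  apply: prodr_ge0 => q _; rewrite invr_ge0 subr_ge0.
  by rewrite exprn_ile1 // ltW.
set k := (size p).-1; have k0 : (0 < k)%N by rewrite /k -subn1 subn_gt0.
have xk1 : x ^+ k < 1 by rewrite exprn_ilt1 // ?ltW // -lt0n.
(* The Euler factor c = 1/(1 - x^k) satisfies c A = A + x^k c A: the first term accounts for the f
   prime to [p], the second for the multiples of [p]. *)
have Ek : (1 - x ^+ k)^-1 * A = A + x ^+ k * ((1 - x ^+ k)^-1 * A).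
  by field; rewrite subr_eq0 eq_sym lt_eqF.
have B0 : 0 <= x ^+ k * ((1 - x ^+ k)^-1 * A).
  apply: mulr_ge0; first by rewrite exprn_ge0 ?ltW.
  by apply: mulr_ge0 => //; rewrite invr_ge0 subr_ge0 ltW.
(* A second induction, on the degree with [p :: L] fixed, since f / p may again be divisible by
   [p]. *)
have [N] := ubnP n; elim: N n => [//|N IHn] n; rewrite ltnS => nN.
have [s Hs ms] := IH n HL.
have [nk|kn] := ltnP n k.
  exists s; first by apply: (le_trans Hs); rewrite Ek lerDl.
  move=> f fm sf H; apply: ms => // q qm iq qf.
  move: (H _ qm iq qf); rewrite inE => /predU1P[Eq|//].
  have := dvdp_leq (monic_neq0 fm) qf; rewrite sf Eq.
  by rewrite -(prednK (ltnW sp)) ltnS leqNgt nk.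
have [|s' Hs' ms'] := IHn (n - k)%N.
  by rewrite (leq_trans _ nN) // ltn_subrL k0 (leq_trans k0).
exists (s ++ [seq p * h | h <- s']).
  rewrite size_cat size_map natrD mulrDl Ek lerD //.
  rewrite -[X in x ^+ X](subnK kn) exprD mulrA [leRHS]mulrC.
  by rewrite ler_wpM2r // exprn_ge0 // ltW.
move=> f fm sf H; rewrite mem_cat; have [pf|npf] := boolP (p %| f); last first.
  apply/orP; left; apply: ms => // q qm iq qf.
  move: (H _ qm iq qf); rewrite inE => /predU1P[Eq|//].
  by rewrite -Eq qf in npf.
apply/orP; right; apply/mapP; exists (f %/ p); last by rewrite mulrC divpK.
have Ef : f = p * (f %/ p) by rewrite mulrC divpK.
apply: ms'.
- by rewrite -(monicMl _ pm) -Ef.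
- by rewrite size_divp ?monic_neq0 // sf subSn.
- move=> q qm iq qf; apply: H => //; rewrite Ef; exact: dvdp_mull.
Qed.

(** The list [L] holds all q^k monic polynomials of each degree k from 1 to m, prime or not, so no
    count of primes enters. *)
Lemma smooth_bound (R : realFieldType) (F : finFieldType) (x : R)
    (m n : nat) :
  0 < x -> x < 1 ->
  exists2 s : seq {poly F},
    (size s)%:R * x ^+ n <=
      \prod_(k < m) (1 - x ^+ k.+1)^-1 ^+ (#|F| ^ k.+1) &
    forall f, f \is monic -> size f = n.+1 ->
      (forall p, p \is monic -> irreducible_poly p -> p %| f ->
         (size p <= m.+1)%N) ->
      f \in s.
Proof.
move=> x0 x1.
pose L :=
  [seq 'X^(i.+1) + val g | i <- iota 0 m, g <- enum {: {poly_(i.+1) F}}].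
have memL p : p \is monic -> (1 < size p <= m.+1)%N -> p \in L.
  move=> pm /andP[sp1 spm].
  have Es : size p = (size p).-2.+2 by case: (size p) sp1 => [|[|]].
  have [g Eg] := monic_XnDnpolyP pm Es.
  apply/allpairsPdep; exists (size p).-2, g; split => //.
    by rewrite mem_iota /= add0n; rewrite Es in spm.
  by rewrite mem_enum.
have HL p : p \in L -> p \is monic /\ (1 < size p)%N.
  move=> /allpairsPdep[i [g [_ _ ->]]].
  by rewrite monic_XnDnpoly size_XnDnpoly.
have [s Hs ms] := smooth_rankin_bound n x0 x1 HL; exists s; last first.
  move=> f fm sf H; apply: ms => // p pm ip pf; apply: memL => //.
  by rewrite H //; case: ip => ->.
apply: le_trans Hs _; rewrite le_eqVlt; apply/orP; left; apply/eqP.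
rewrite big_allpairs_dep -[X in iota 0 X]subn0 -/(index_iota 0 m) big_mkord.
apply: eq_bigr => i _; rewrite big_enum /=.
under eq_bigr do rewrite size_XnDnpoly /=.
by rewrite prodr_const card_npoly.
Qed.

(** * Multiples of high powers, and the covering of T(n) *)

Definition power_multiples (F : finFieldType) (n k e : nat) :
    {set {poly_n.+1 F}} :=
  [set f : {poly_n.+1 F} | [&& val f \is monic, size (val f) == n.+1 &
     [exists g : {poly_k F}, ('X^k + val g) ^+ e %| val f]]].

(** There are q^k monic bases and q^(n-ke) monic cofactors. The product form also covers ke > n,
    where the set is empty. *)
Lemma card_power_multiples (F : finFieldType) (n k e : nat) :
  (#|power_multiples F n k e| * #|F| ^ (k * e) <= #|F| ^ (n + k))%N.
Proof.
have sXe (g : {poly_k F}) : size (('X^k + val g) ^+ e) = (k * e).+1.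
  have := size_exp ('X^k + val g) e; rewrite size_XnDnpoly /= => <-.
  by rewrite prednK // size_poly_gt0 monic_neq0 // monic_exp // monic_XnDnpoly.
have [ken|nke] := leqP (k * e) n; last first.
  suff -> : power_multiples F n k e = finset.set0 by rewrite cards0.
  apply/setP => f; rewrite !inE; apply/negP => /and3P[fm /eqP sf /existsP[g]].
  by move=> /(dvdp_leq (monic_neq0 fm)); rewrite sXe sf ltnS leqNgt nke.
pose phi (u : {poly_k F} * {poly_(n - k * e) F}) :=
  npolyp n.+1 (('X^k + val u.1) ^+ e * ('X^(n - k * e) + val u.2)).
have : power_multiples F n k e \subset [set phi u | u in [set: _]].
  apply/fintype.subsetP => f; rewrite !inE => /and3P[fm /eqP sf /existsP[g gf]].
  have Ef : val f = ('X^k + val g) ^+ e * (val f %/ ('X^k + val g) ^+ e).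
    by rewrite mulrC divpK.
  set h := _ %/ _ in Ef.
  have hm : h \is monic.
    by rewrite -(monicMl _ (monic_exp e (monic_XnDnpoly g))) -Ef.
  have sh : size h = (n - k * e).+1.
    rewrite size_divp ?sXe /= ?sf ?subSn // monic_neq0 // monic_exp //.
    exact: monic_XnDnpoly.
  have [h' Eh] := monic_XnDnpolyP hm sh.
  apply/imsetP; exists (g, h') => //; apply: val_inj.
  by rewrite /= npolypK -Eh -Ef // sf.
move=> /subset_leq_card /leq_trans /(_ (leq_imset_card _ _)).
rewrite cardsT card_prod !card_npoly => H.
apply: leq_trans (leq_mul H (leqnn _)) _.
by rewrite -!expnD leq_exp2l ?card_finNzRing_gt1 // -addnA subnK // addnC.
Qed.

Lemma card_bigcup_le (T I : finType) (A : I -> {set T}) :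
  (#|\bigcup_i A i| <= \sum_i #|A i|)%N.
Proof.
elim/big_rec2: _ => [|i n B _ H]; first by rewrite cards0.
by apply: leq_trans (leq_card_setU _ _) _; rewrite leq_add2l.
Qed.

Lemma card_preim_seq_le (T : finType) (U : eqType) (f : T -> U) (s : seq U) :
  injective f -> (#|[set x | f x \in s]| <= size s)%N.
Proof.
move=> fI; rewrite cardE -(size_map f); apply: uniq_leq_size.
  by rewrite map_inj_uniq // enum_uniq.
by move=> _ /mapP[x + ->]; rewrite mem_enum inE.
Qed.

(** Either all prime factors of f have degree below D and f lies in [s], or f has a divisor p^(1 +
    q^j) with i = deg P - D and j = deg P - deg p, so that D + i - j = deg p. *)
Lemma card_Tset_le (F : finFieldType) (a : #|F|.-tuple F) (n D : nat)
    (s : seq {poly F}) :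
  uniq a -> a`_0 = 0 -> a`_1 = 1 -> (0 < n)%N ->
  (forall f, f \is monic -> size f = n.+1 ->
     (forall p, p \is monic -> irreducible_poly p -> p %| f ->
        (size p <= D)%N) -> f \in s) ->
  (#|Tset a n| <= size s +
    \sum_(i < n.+1) \sum_(j < D + i)
      #|power_multiples F n (D + i - j) (#|F| ^ j).+1|)%N.
Proof.
move=> ua a0 a1 n0 Hs.
apply: (@leq_trans (#|[set f : {poly_n.+1 F} | val f \in s] :|:
  \bigcup_(i < n.+1) \bigcup_(j < D + i)
    power_multiples F n (D + i - j) (#|F| ^ j).+1|)).
  apply: subset_leq_card; apply/fintype.subsetP => f; rewrite 3!inE.
  move=> /and3P[fm /eqP sf fT].
  have sf1 : (1 < size (val f))%N by rewrite sf.
  have [[Pm Pi Pf] Pmax] := max_primeP ua sf1.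
  have [p [pm ip pP pf]] := smarandache_neqXn ua a0 a1 sf1 fT.
  set P := max_prime a (val f) in Pm Pi Pf Pmax pP pf.
  have sP1 : (1 < size P)%N by case: Pi.
  have sp1 : (1 < size p)%N by case: ip.
  have [PD|DP] := leqP (size P) D.
    rewrite Hs // => r rm ir rf; apply: leq_trans PD.
    have := Pmax _ (And3 rm ir rf); rewrite leq_eqVlt => /predU1P[|].
      by move/(delta_inj ua a0) ->.
    exact: delta_size.
  apply/orP; right.
  have sPn : (size P <= n.+1)%N.
    by rewrite -sf (dvdp_leq (monic_neq0 fm)).
  have hi : ((size P).-1 - D < n.+1)%N.
    by rewrite ltnS (leq_trans (leq_subr _ _)) // -ltnS prednK // ltnW.
  have DP' : (D <= (size P).-1)%N by rewrite -ltnS prednK // ltnW.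
  apply/bigcupP; exists (Ordinal hi) => //.
  have hj : (size P - size p < D + Ordinal hi)%N.
    rewrite /= subnKC //; clear -sp1 sP1 pP; move: (size p) (size P) sp1 sP1 pP.
    by move=> b c; lia.
  apply/bigcupP; exists (Ordinal hj) => //.
  rewrite inE fm sf eqxx /=.
  have -> : (D + ((size P).-1 - D) - (size P - size p) = (size p).-1)%N.
    rewrite subnKC //; clear -sp1 sP1 pP; move: (size p) (size P) sp1 sP1 pP.
    by move=> b c; lia.
  have [g Eg] := monic_XnDnpolyP pm (esym (prednK (ltnW sp1))).
  by apply/existsP; exists g; rewrite -Eg.
apply: leq_trans (leq_card_setU _ _) _; apply: leq_add.
  exact: card_preim_seq_le val_inj.
apply: leq_trans (card_bigcup_le _) _; apply: leq_sum => i _.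
exact: card_bigcup_le.
Qed.

Lemma geometric_sum_le (R : realFieldType) (w : R) (n : nat) :
  0 <= w -> w < 1 -> \sum_(i < n) w ^+ i <= (1 - w)^-1.
Proof.
move=> w0 w1; have w1' : 0 < 1 - w by rewrite subr_gt0.
rewrite -[leRHS]mul1r ler_pdivlMr // mulrC.
have := subrXX 1 w n; rewrite expr1n.
under eq_bigr do rewrite expr1n mul1r.
by move=> <-; rewrite gerBl exprn_ge0.
Qed.

(** With d = D + i and k = d - j, a term is at most q^(n - k q^j), hence at most q^(n - D - i - rj)
    by hypothesis; the double sum is bounded by two geometric series. *)
Lemma sum_power_multiples_le (R : realFieldType) (F : finFieldType)
    (n D r : nat) :
  (0 < r)%N ->
  (forall d j, (D <= d)%N -> (j < d)%N -> d + r * j <= (d - j) * #|F| ^ j)%N ->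
  (\sum_(i < n.+1) \sum_(j < D + i)
     #|power_multiples F n (D + i - j) (#|F| ^ j).+1|)%:R <=
  #|F|%:R ^+ n * (#|F|%:R ^+ D)^-1 *
    ((1 - #|F|%:R^-1)^-1 * (1 - (#|F|%:R ^+ r)^-1)^-1) :> R.
Proof.
move=> r0 Hr; set q : R := #|F|%:R.
have q1 : 1 < q by rewrite ltr1n card_finNzRing_gt1.
have q0 : 0 < q by exact: lt_trans q1.
have qV0 : 0 <= q^-1 by rewrite invr_ge0 ltW.
have qX0 k : 0 <= (q ^+ k)^-1 by rewrite -exprVn exprn_ge0.
have qn0 : 0 <= q ^+ n * (q ^+ D)^-1 by rewrite mulr_ge0 // exprn_ge0 // ltW.
have qr1 : (q ^+ r)^-1 < 1.
  by rewrite invf_lt1 ?exprn_gt0 // exprn_egt1 // -lt0n.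
have term (i : 'I_n.+1) (j : 'I_(D + i)) :
    #|power_multiples F n (D + i - j) (#|F| ^ j).+1|%:R <=
      q ^+ n * (q ^+ D)^-1 * (q^-1 ^+ i * (q ^+ r)^-1 ^+ j).
  have Hq := card_power_multiples F n (D + i - j) (#|F| ^ j).+1.
  have -> : q ^+ n * (q ^+ D)^-1 * (q^-1 ^+ i * (q ^+ r)^-1 ^+ j) =
      q ^+ n / q ^+ (D + i + r * j).
    by rewrite !exprD !invfM !exprVn exprM !mulrA.
  rewrite ler_pdivlMr ?exprn_gt0 // /q -!natrX -natrM ler_nat.
  rewrite mulnS expnD mulnA (addnC n) expnD in Hq.
  have {}Hq : (#|power_multiples F n (D + i - j) (#|F| ^ j).+1| *
      #|F| ^ ((D + i - j) * #|F| ^ j) <= #|F| ^ n)%N.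
    rewrite -(@leq_pmul2l (#|F| ^ (D + i - j))) ?expn_gt0; last first.
      by rewrite (ltnW (card_finNzRing_gt1 _)).
    by rewrite (leq_trans _ Hq) // mulnCA mulnA.
  apply: leq_trans Hq; rewrite leq_mul2l leq_exp2l ?card_finNzRing_gt1 //.
  by rewrite Hr ?orbT ?leq_addr.
rewrite natr_sum.
apply: le_trans (_ : \sum_(i < n.+1) q ^+ n * (q ^+ D)^-1 *
    (q^-1 ^+ i * (1 - (q ^+ r)^-1)^-1) <= _).
  apply: ler_sum => i _; rewrite natr_sum.
  apply: le_trans (ler_sum _ (fun j _ => term i j)) _.
  rewrite -!mulr_sumr ler_wpM2l // ler_wpM2l ?exprn_ge0 //.
  exact: geometric_sum_le.
rewrite -mulr_sumr -mulr_suml ler_wpM2l // ler_wpM2r //.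
  by rewrite invr_ge0 subr_ge0 ltW.
by rewrite geometric_sum_le // invf_lt1.
Qed.

(** * Rankin's bound *)

Lemma inv_subr_le_expR (R : realType) (t : R) :
  t < 1 -> (1 - t)^-1 <= expR (t / (1 - t)).
Proof.
move=> t1; apply: le_trans (expR_ge1Dx _).
have t1' : 1 - t != 0 by rewrite subr_eq0 gt_eqF.
rewrite le_eqVlt; apply/orP; left; apply/eqP; by field.
Qed.

Lemma sum_inv_subr_pow (R : fieldType) (z : R) (m : nat) :
  z != 0 -> 1 - z != 0 ->
  \sum_(k < m) (1 - z)^-1 ^+ k.+1 = ((1 - z)^-1 ^+ m - 1) / z.
Proof.
move=> z0 z1; elim: m => [|m IH]; first by rewrite big_ord0 expr0 subrr mul0r.
rewrite big_ord_recr /= IH exprS; set y := _ ^+ m.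
by field; rewrite z0 z1.
Qed.

(** Each factor obeys 1/(1 - x^k) <= exp(x^k/(1 - x)). Since q^k x^k = (1 - z)^(-k), the exponents
    form a geometric sum. *)
Lemma euler_prod_le (R : realType) (q m : nat) (z x : R) :
  0 < z -> z < 1 -> 1 < q%:R * (1 - z) -> x = (q%:R * (1 - z))^-1 ->
  \prod_(k < m) (1 - x ^+ k.+1)^-1 ^+ (q ^ k.+1) <=
    expR ((1 - x)^-1 * (((1 - z)^-1 ^+ m - 1) / z)).
Proof.
move=> z0 z1 qz Ex; have y0 : 0 < 1 - z by rewrite subr_gt0.
have x0 : 0 < x by rewrite Ex invr_gt0 (lt_trans _ qz).
have x1 : x < 1 by rewrite Ex invf_lt1 // (lt_trans _ qz).
rewrite -sum_inv_subr_pow ?gt_eqF // mulr_sumr expR_sum.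
apply: ler_prod => k _; have xk1 : x ^+ k.+1 < 1.
  by rewrite exprn_ilt1 // ltW.
have xk0 : 0 <= x ^+ k.+1 by rewrite exprn_ge0 // ltW.
have V0 : 0 <= (1 - x ^+ k.+1)^-1 by rewrite invr_ge0 subr_ge0 ltW.
rewrite exprn_ge0 //=.
apply: le_trans (_ : expR (x ^+ k.+1 / (1 - x ^+ k.+1)) ^+ (q ^ k.+1) <= _).
  by apply: lerXn2r; rewrite ?nnegrE ?expR_ge0 ?inv_subr_le_expR.
rewrite -expRM_natl ler_expR natrX mulrA.
have -> : (q%:R ^+ k.+1 * x ^+ k.+1 : R) = (1 - z)^-1 ^+ k.+1.
  rewrite -exprMn Ex invfM mulrA divff ?mul1r // gt_eqF //.
  by move: qz; rewrite -(pmulr_lgt0 _ y0); apply: lt_trans.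
rewrite mulrC ler_wpM2r ?exprn_ge0 ?invr_ge0 ?(ltW y0) //.
rewrite lef_pV2 ?posrE ?subr_gt0 // lerD2l lerN2.
by rewrite exprS ger_pMr // exprn_ile1 // ltW.
Qed.

(** Dividing Rankin's bound by x^n leaves x^(-n) = q^n (1 - z)^n <= q^n exp(-nz). *)
Lemma smooth_count_le (R : realType) (F : finFieldType) (m n : nat) (z : R) :
  0 < z -> z < 1 -> 1 < #|F|%:R * (1 - z) ->
  exists2 s : seq {poly F},
    (size s)%:R <= #|F|%:R ^+ n * expR (- (n%:R * z) +
      (1 - (#|F|%:R * (1 - z))^-1)^-1 * (((1 - z)^-1 ^+ m - 1) / z)) &
    forall f, f \is monic -> size f = n.+1 ->
      (forall p, p \is monic -> irreducible_poly p -> p %| f ->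
         (size p <= m.+1)%N) ->
      f \in s.
Proof.
move=> z0 z1 qz; set x := (_ * _)^-1.
have qz0 : 0 < #|F|%:R * (1 - z) by exact: lt_trans qz.
have x0 : 0 < x by rewrite invr_gt0.
have x1 : x < 1 by rewrite invf_lt1.
have [s Hs ms] := smooth_bound F m n x0 x1; exists s => //.
have {Hs} := le_trans Hs (euler_prod_le m z0 z1 qz (erefl x)).
set E := expR _ => Hs; rewrite expRD -/E.
rewrite -ler_pdivlMr ?exprn_gt0 // in Hs; apply: le_trans Hs _.
rewrite /x -exprVn invrK exprMn mulrC -mulrA ler_wpM2l ?exprn_ge0 //.
rewrite ler_wpM2r ?expR_ge0 // -mulrN expRM_natl.
apply: lerXn2r; rewrite ?nnegrE ?expR_ge0 ?subr_ge0 ?(ltW z1) //.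
exact: expR_ge1Dx.
Qed.

(** * Smooth and non-smooth contributions combined *)

Lemma card_Tset_bound (R : realType) (F : finFieldType) (a : #|F|.-tuple F)
    (n r : nat) (t z : R) :
  uniq a -> a`_0 = 0 -> a`_1 = 1 -> (0 < n)%N ->
  0 < t -> 0 < z -> z < 1 -> 1 < #|F|%:R * (1 - z) -> (0 < r)%N ->
  (forall d j, expR t <= #|F|%:R ^+ d -> (j < d)%N ->
     (d + r * j <= (d - j) * #|F| ^ j)%N) ->
  exists2 m, #|F|%:R ^+ m < expR t &
    #|Tset a n|%:R <= #|F|%:R ^+ n *
      (expR (- (n%:R * z) + (1 - (#|F|%:R * (1 - z))^-1)^-1 *
          (((1 - z)^-1 ^+ m - 1) / z)) +
       expR (- t) * ((1 - #|F|%:R^-1)^-1 * (1 - (#|F|%:R ^+ r)^-1)^-1)).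
Proof.
move=> ua a0 a1 n0 t0 z0 z1 qz r0 Hr.
have q1 : 1 < #|F|%:R :> R by rewrite ltr1n card_finNzRing_gt1.
have q0 : 0 < #|F|%:R :> R by exact: lt_trans q1.
have exD : exists D, expR t <= #|F|%:R ^+ D.
  exists (Num.bound (expR t)); apply: le_trans (ltW (archi_boundP _)) _.
    exact: expR_ge0.
  by rewrite -natrX ler_nat ltnW // ltn_expl // card_finNzRing_gt1.
(* The least D is positive because exp t > 1. Writing D = m + 1, minimality gives q^m < exp t, from
   which m is later bounded linearly in sqrt n. *)
case: (ex_minnP exD) => -[|m] Dt Dmin.
  by move: Dt; rewrite expr0 leNgt expR_gt1 t0.
exists m.
  by rewrite ltNge; apply/negP => /Dmin; rewrite ltnn.
have [s Hs ms] := @smooth_count_le R F m n z z0 z1 qz.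
have := card_Tset_le ua a0 a1 n0 ms; rewrite -(ler_nat R) natrD.
move=> /le_trans; apply; rewrite mulrDr; apply: lerD => //.
have HD d j : (m.+1 <= d)%N -> (j < d)%N ->
    (d + r * j <= (d - j) * #|F| ^ j)%N.
  move=> md; apply: Hr; apply: le_trans Dt _.
  by rewrite ler_weXn2l // ltW.
apply: le_trans (sum_power_multiples_le R n r0 HD) _.
rewrite [leRHS]mulrA ler_wpM2r //.
  rewrite mulr_ge0 // invr_ge0 subr_ge0 ltW // invf_lt1 ?exprn_gt0 //.
  by rewrite exprn_egt1 // -lt0n.
rewrite ler_wpM2l ?exprn_ge0 ?(ltW q0) // expRN lef_pV2 // posrE ?expR_gt0 //.
by rewrite exprn_gt0.
Qed.

(** Uses exp(-t) = exp(-t/N)^N >= (1 - t/N)^N, which reduces an upper bound on exp t to rational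
    arithmetic. *)
Lemma expR_le_of_pow (R : realType) (N : nat) (t d : R) :
  (0 < N)%N -> t <= N%:R -> 0 <= d -> 1 <= d * (1 - t / N%:R) ^+ N ->
  expR t <= d.
Proof.
move=> N0 tN d0 H; rewrite -[t]opprK expRN -[leLHS]mul1r.
rewrite ler_pdivrMr ?expR_gt0 //; apply: le_trans H _.
have N0' : 0 < N%:R :> R by rewrite ltr0n.
have -> : - t = N%:R * - (t / N%:R) by field; rewrite gt_eqF.
rewrite expRM_natl ler_wpM2l //; apply: lerXn2r; rewrite ?nnegrE ?expR_ge0 //.
  by rewrite subr_ge0 ler_pdivrMr // mul1r.
exact: expR_ge1Dx.
Qed.

(** A lower bound for log 2: it turns 2^m < exp(s/3) into 33 m / 16 <= s. *)
Lemma expR_11_16_le (R : realType) : expR (11 / 16) <= 2 :> R.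
Proof. by apply: (@expR_le_of_pow R 64) => //; lra. Qed.

Lemma expR_152_99_le (R : realType) : expR (152 / 99) <= 43 / 9 :> R.
Proof. by apply: (@expR_le_of_pow R 64) => //; lra. Qed.

Lemma expR_19_12_le (R : realType) : expR (19 / 12) <= 29 / 5 :> R.
Proof. by apply: (@expR_le_of_pow R 32) => //; lra. Qed.

Lemma expR_1_le (R : realType) : expR 1 <= 3 :> R.
Proof. by apply: (@expR_le_of_pow R 16) => //; lra. Qed.

(** * Numerical estimates *)

Lemma linear_lt_expn2 (j : nat) : (4 <= j -> 3 * j < 2 ^ j)%N.
Proof.
elim: j => // j IH; rewrite leq_eqVlt => /predU1P[[<-]//|j4].
by have := IH j4; rewrite expnS; lia.
Qed.

(** For j >= 4, 2^j >= 3j + 1 and d - j >= 1 suffice; smaller j are checked singly. The bound d >= 5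
    is sharp: d = 4, j = 3 fails. *)
Lemma multiplicity_exponent2 (d j : nat) :
  (5 <= d)%N -> (j < d)%N -> (d + 2 * j <= (d - j) * 2 ^ j)%N.
Proof.
move=> d5 jd; have [j4|] := leqP 4 j.
  by have := linear_lt_expn2 j4; nia.
by move: j jd => [|[|[|[|]]]] //=; lia.
Qed.

Lemma multiplicity_exponent3 (q d j : nat) :
  (3 <= q)%N -> (j < d)%N -> (d + 1 * j <= (d - j) * q ^ j)%N.
Proof.
move=> q3 jd; have : (2 * j < q ^ j)%N.
  elim: j {jd} => [|j IH]; first by rewrite expn0.
  by rewrite expnS; nia.
nia.
Qed.

(* With z = 3 / s the exponent in Rankin's bound is - 3 s + C (y ^ m - 1) s / 3,
   where y = 1 / (1 - z). *)
Lemma rankin_exponent_le (R : realType) (q m n : nat) (s b c C E : R) :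
  s = Num.sqrt n%:R -> 57 <= s -> 0 < b -> m%:R * b <= s -> 0 < C ->
  (0 < q)%N -> 19 * C <= q%:R * (18 * (C - 1)) ->
  expR (3 / b * (19 / 18)) <= E -> C * (E - 1) <= 9 - 3 * c ->
  - (n%:R * (3 / s)) + (1 - (q%:R * (1 - 3 / s))^-1)^-1 *
    (((1 - 3 / s)^-1 ^+ m - 1) / (3 / s)) <= - (s * c).
Proof.
move=> Es s57 b0 mb C0 q0 qC HE HC.
have s0 : 0 < s by lra.
have En : n%:R = s ^+ 2 by rewrite Es sqr_sqrtr.
have -> : n%:R * (3 / s) = 3 * s by rewrite En; field; rewrite gt_eqF.
set z := 3 / s; have z0 : 0 < z by rewrite divr_gt0.
have z19 : z <= 1 / 19 by rewrite /z ler_pdivrMr //; lra.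
have y0 : 0 < 1 - z by lra.
have q0' : 0 < q%:R :> R by rewrite ltr0n.
have qy0 : 0 < q%:R * (1 - z) by rewrite mulr_gt0.
(* As 1 - z >= 18/19, the hypothesis on [C] gives 1/(q(1 - z)) <= 19/(18q) <= 1 - 1/C. *)
have HCx : (1 - (q%:R * (1 - z))^-1)^-1 <= C.
  have Cx : C * (q%:R * (1 - z))^-1 <= C - 1.
    rewrite ler_pdivrMr //; nra.
  have x1 : 0 < 1 - (q%:R * (1 - z))^-1 by nra.
  by rewrite -[leLHS]mul1r ler_pdivrMr // mulrBr mulr1; lra.
(* Here y^m <= exp(m z/(1 - z)); with m <= s/b and z = 3/s the variable s cancels, leaving a
   constant. *)
have HyE : (1 - z)^-1 ^+ m <= E.
  apply: le_trans HE.
  apply: le_trans (_ : expR (z / (1 - z)) ^+ m <= _).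
    apply: lerXn2r; rewrite ?nnegrE ?expR_ge0 ?invr_ge0 ?(ltW y0) //.
    by apply: inv_subr_le_expR; lra.
  rewrite -expRM_natl ler_expR.
  have mbs : m%:R <= s / b by rewrite ler_pdivlMr.
  have zy : z / (1 - z) <= 3 / s * (19 / 18).
    by rewrite ler_pdivrMr // -/z; nra.
  have -> : 3 / b * (19 / 18) = s / b * (3 / s * (19 / 18)).
    by field; rewrite !gt_eqF.
  by apply: ler_pM => //; rewrite divr_ge0 // ltW.
have Hy1 : 0 <= (1 - z)^-1 ^+ m - 1.
  by rewrite subr_ge0 exprn_ege1 // invf_ge1 //; lra.
have -> : ((1 - z)^-1 ^+ m - 1) / z = ((1 - z)^-1 ^+ m - 1) * (s / 3).
  by rewrite /z invf_div.
have : (1 - (q%:R * (1 - z))^-1)^-1 * (((1 - z)^-1 ^+ m - 1) * (s / 3)) <=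
    C * ((E - 1) * (s / 3)).
  apply: le_trans (_ : C * (((1 - z)^-1 ^+ m - 1) * (s / 3)) <= _).
    by rewrite ler_wpM2r // mulr_ge0 //; lra.
  by rewrite ler_wpM2l ?(ltW C0) // ler_wpM2r; lra.
have : C * ((E - 1) * (s / 3)) <= (9 - 3 * c) * (s / 3).
  by rewrite mulrA ler_wpM2r //; lra.
lra.
Qed.

Theorem theorem4p1 (R : realType) (F : finFieldType) (a : #|F|.-tuple F)
    (a_uniq : uniq a) (a_0 : a`_0 = 0) (a_1 : a`_1 = 1)
    (n : nat) (n_ge1 : (1 <= n)%N) :
  (#|F| = 2%N -> (3249 <= n)%N ->
     (#|Tset a n|%:R : R) < 2 ^+ (n + 2) * expR (- (Num.sqrt n%:R / 3)))
  /\
  ((3 <= #|F|)%N -> Num.max 13000 (ln (#|F|%:R : R)) <= n%:R ->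
     (#|Tset a n|%:R : R) < 4 * #|F|%:R ^+ n * expR (- (Num.sqrt n%:R / 2))).
Proof.
have sqrt57 : (3249 <= n)%N -> 57 <= Num.sqrt (n%:R : R).
  move=> n57; have -> : 57 = Num.sqrt (57 ^+ 2) :> R.
    by rewrite sqrtr_sqr ger0_norm.
  by rewrite ler_sqrt // -natrX ler_nat.
set s := Num.sqrt n%:R in sqrt57 *; split.
  move=> q2 /sqrt57 s57.
  have z0 : 0 < 3 / s by rewrite divr_gt0 //; lra.
  have z19 : 3 / s <= 1 / 19 by rewrite ler_pdivrMr; lra.
  have q2R : #|F|%:R = 2 :> R by rewrite q2.
  (* Taking r = 2 makes the geometric constant 8/3; r = 1 would give 4, leaving no room for the
     smooth part. *)
  have [||||||m Hm HT] := @card_Tset_bound R F a n 2 (s / 3) (3 / s) a_uniq a_0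
    a_1 n_ge1.
  - lra.
  - lra.
  - lra.
  - rewrite q2R; lra.
  - by [].
  (* From s >= 57, exp(s/3) >= 20 > 2^4, which forces d >= 5. *)
  - move=> d j; rewrite q2R q2 => Hd jd; apply: multiplicity_exponent2 => //.
    rewrite leqNgt; apply/negP => d4.
    have d16 : 2 ^+ d <= 2 ^+ 4 :> R by rewrite ler_weXn2l //; lra.
    have := expR_ge1Dx (s / 3); lra.
  rewrite q2R in Hm HT; apply: le_lt_trans HT _.
  have mb : m%:R * (33 / 16) <= s.
    have : expR (m%:R * (11 / 16)) <= expR (s / 3).
      rewrite expRM_natl; apply: le_trans (ltW Hm).
      by apply: lerXn2r; rewrite ?nnegrE ?expR_ge0 ?expR_11_16_le.
    rewrite ler_expR; lra.
  have HE : expR (3 / (33 / 16) * (19 / 18)) <= 43 / 9 :> R.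
    apply: le_trans (expR_152_99_le R); rewrite ler_expR; lra.
  (* [C] = 36/17 solves 19 C = 36 (C - 1), and [E] = 43/9 then makes C (E - 1) = 8 = 9 - 3c
     exactly. *)
  have := @rankin_exponent_le R 2 m n s (33 / 16) (1 / 3) (36 / 17) (43 / 9)
    erefl s57 ltac:(lra) mb ltac:(lra) isT ltac:(lra) HE ltac:(lra).
  rewrite -ler_expR.
  set A := expR (_ + _); have -> : - (s * (1 / 3)) = - (s / 3) by lra.
  have B0 := expR_gt0 (- (s / 3)); set B := expR (- (s / 3)) in B0 *.
  move=> AB; have q0 : 0 < 2 ^+ n :> R by rewrite exprn_gt0.
  have K : (1 - 2^-1)^-1 * (1 - (2 ^+ 2)^-1)^-1 = 8 / 3 :> R by field.
  (* Smooth and non-smooth parts add up to 1 + 8/3 < 4 times 2^n exp(-s/3). *)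
  rewrite exprD -mulrA ltr_pM2l // K; lra.
move=> q3; rewrite ge_max => /andP[n13 _].
have s57 : 57 <= s.
  by apply: sqrt57; rewrite -(ler_nat R); lra.
clear n13.
have z0 : 0 < 3 / s by rewrite divr_gt0 //; lra.
have z19 : 3 / s <= 1 / 19 by rewrite ler_pdivrMr; lra.
have q3R : 3 <= #|F|%:R :> R by rewrite ler_nat.
have [||||||m Hm HT] := @card_Tset_bound R F a n 1 (s / 2) (3 / s) a_uniq a_0
  a_1 n_ge1.
- lra.
- lra.
- lra.
- nra.
- by [].
- by move=> d j _ jd; apply: multiplicity_exponent3.
apply: le_lt_trans HT _; set q := #|F|%:R in q3R Hm *.
(* Because e <= 3 <= q, e^m <= q^m < exp(s/2). *)
have mb : m%:R * 2 <= s.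
  have : expR (m%:R * 1) <= expR (s / 2).
    rewrite expRM_natl; apply: le_trans (ltW Hm).
    apply: lerXn2r; rewrite ?nnegrE ?expR_ge0 //.
    exact: le_trans (expR_1_le R) q3R.
  rewrite ler_expR; lra.
have HE : expR (3 / 2 * (19 / 18)) <= 29 / 5 :> R.
  apply: le_trans (expR_19_12_le R); rewrite ler_expR; lra.
(* [C] = 54/35 is the equality case at q = 3; C (E - 1) = 1296/175 stays below 9 - 3/2. *)
have := @rankin_exponent_le R #|F| m n s 2 (1 / 2) (54 / 35) (29 / 5)
  erefl s57 ltac:(lra) mb ltac:(lra) (ltnW (ltnW q3)) ltac:(lra) HE ltac:(lra).
rewrite -ler_expR -/q.
set A := expR (_ + _); have -> : - (s * (1 / 2)) = - (s / 2) by lra.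
have B0 := expR_gt0 (- (s / 2)); set B := expR (- (s / 2)) in B0 *.
move=> AB; have q0 : 0 < q ^+ n by rewrite exprn_gt0 //; lra.
have qV : q^-1 <= 1 / 3 by rewrite -[leLHS]mul1r ler_pdivrMr; lra.
have qV' : (1 - q^-1)^-1 <= 3 / 2.
  by rewrite -[leLHS]mul1r ler_pdivrMr; lra.
have qV0 : 0 <= (1 - q^-1)^-1 by rewrite invr_ge0; lra.
(* The final constant is 1 + 9/4 < 4. *)
have qVV : (1 - q^-1)^-1 * (1 - (q ^+ 1)^-1)^-1 <= 3 / 2 * (3 / 2).
  by rewrite expr1 ler_pM.
rewrite (mulrC 4) -mulrA ltr_pM2l //.
have : B * ((1 - q^-1)^-1 * (1 - (q ^+ 1)^-1)^-1) <= B * (3 / 2 * (3 / 2)).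
  by rewrite ler_wpM2l // ltW.
lra.
Qed.
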